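(* Let $k \geq 3$ and $m \geq 2$ be integers and let $n = m(k+1)$. Let $G_{n,k}$ be the graph constructed as follows: (1) take $m$ vertex-disjoint copies $K^1_{k+1}, K^2_{k+1}, \ldots, K^m_{k+1}$ of the complete graph $K_{k+1}$; (2) delete one edge from $K^1_{k+1}$, calling its endpoints $a_1$ and $v_1$, and delete one edge from $K^m_{k+1}$, calling its endpoints $b_m$ and $v_m$; (3) for each $j = 2, \ldots, m-1$, delete two edges of $K^j_{k+1}$ that share a common endpoint, calling the common endpoint $v_j$ and the other endpoints of the two deleted edges $a_j$ and $b_j$; (4) add the edges $(v_i, v_{i+1})$ and $(a_i, b_{i+1})$ for every $i = 1, \ldots, m-1$. Then $G_{n,k}$ is a $k$-regular graph on $n$ vertices, and its number of Hamiltonian cycles is $$h(n,k) = (k-1)^2\left[(k-2)!\right]^{\frac{n}{k+1}}.$$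
   Context: A Hamiltonian cycle of a graph on $n$ vertices is a simple cycle of length $n$ (a cycle passing through every vertex exactly once), counted as an undirected cycle, i.e. as a subgraph, so that a cycle and its reversal (and its rotations) count once. *)

(* Defs.v *)
From mathcomp Require Import all_boot.

Set Implicit Arguments.
Unset Strict Implicit.
Unset Printing Implicit Defensive.

Section SimpleGraphs.

Variables (T : finType) (e : rel T).

Definition simple_graph := symmetric e /\ irreflexive e.

Definition regular (k : nat) := forall x : T, #|[set y | e x y]| = k.

Definition cycle_edges (s : seq T) : {set {set T}} :=
  [set [set x; next s x] | x in s].

(* A Hamiltonian cycle is identified with its set of edges, so all rotations
   and reversals of the same cyclic vertex sequence are counted once. *)
Definition hamiltonian_cycles : {set {set {set T}}} :=
  [set cycle_edges s | s : #|T|.-tuple T & (2 < #|T|) && ucycleb e s].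

End SimpleGraphs.

Section Construction.

(* The copies of K_{k+1} are indexed by 'I_m, from 0 to m - 1; the vertex (j, x)
   is the vertex x of the copy j.  The values of a on the last copy and of b
   on the first copy are never used. *)
Variables (m k : nat) (v a b : 'I_m -> 'I_k.+1).

Notation vertex := ('I_m * 'I_k.+1)%type.

Definition copies : rel vertex :=
  [rel x y : vertex | (x.1 == y.1) && (x.2 != y.2)].

(* The edges v_j a_j (j not the last copy) and v_j b_j (j not the first copy),
   oriented away from v_j. *)
Definition deleted : rel vertex :=
  [rel x y : vertex | [&& x.1 == y.1, x.2 == v x.1 &
     (x.1.+1 < m) && (y.2 == a y.1) || (0 < x.1) && (y.2 == b y.1)]].

(* The edges v_i v_{i+1} and a_i b_{i+1}, oriented towards the copy i + 1. *)
Definition added : rel vertex :=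
  [rel x y : vertex | (x.1.+1 == y.1 :> nat) &&
     ((x.2 == v x.1) && (y.2 == v y.1) || (x.2 == a x.1) && (y.2 == b y.1))].

Definition Gnk : rel vertex :=
  [rel x y : vertex | [|| copies x y && ~~ (deleted x y || deleted y x),
                 added x y | added y x]].

End Construction.

(* Main.v *)
Require Import Defs.
From mathcomp Require Import all_boot zify.

(* Only two edges join the copies up to i to the later ones, so a Hamiltonian
   cycle uses both of them.  Oriented along v_1 v_2, it is therefore a
   Hamiltonian path from v_2 to b_2 in the copies 2, ..., m followed by one from
   a_1 to v_1 in the copy 1.  Likewise, for 1 < j < m, a Hamiltonian path from v_j to
   b_j in the copies j, ..., m goes at once to v_{j+1}, is then a Hamiltonian path from
   v_{j+1} to b_{j+1} in the copies j+1, ..., m, and ends with a Hamiltonian path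
   from a_j to b_j in the copy j without v_j.  The two extreme copies thus
   contribute (k-1)! paths each, and the others (k-2)! paths each. *)

Set Implicit Arguments.
Unset Strict Implicit.
Unset Printing Implicit Defensive.

(** * Hamiltonian paths with prescribed ends in a vertex set *)

Section HamiltonianPaths.

Variables (T : finType) (e : rel T).

(** Paths are vertex sequences oriented from [x] to [y], kept in a duplicate-free list, so that its
    size is their number. *)
Definition ham_paths (S : {set T}) (x y : T) : seq (seq T) :=
  [seq s <- permutations (enum S) |
     if s is z :: p then [&& z == x, path e z p & last z p == y] else false].

Lemma mem_ham_paths (S : {set T}) x y s :
  reflect (exists p, [/\ s = x :: p, path e x p, last x p = y, uniq s & s =i S])
          (s \in ham_paths S x y).
Proof.
have uniqS (t : seq T) :
  t \in permutations (enum S) = uniq t && [forall z, (z \in t) == (z \in S)].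
  rewrite mem_permutations; apply/idP/andP=> [pt | [ut /forallP st]].
    split; first by rewrite (perm_uniq pt) enum_uniq.
    by apply/forallP=> z; rewrite (perm_mem pt) mem_enum.
  by apply: uniq_perm; rewrite ?enum_uniq // => z; rewrite mem_enum (eqP (st z)).
rewrite mem_filter uniqS; apply: (iffP and3P).
  case: s => [|z p] [] //= /and3P[/eqP-> xp /eqP yp] us /forallP sS.
  by exists p; split=> // w; rewrite (eqP (sS w)).
case=> p [-> xp yp up pS]; split=> //; first by rewrite eqxx xp yp eqxx.
by apply/forallP=> w; rewrite pS.
Qed.

Lemma ham_paths_uniq S x y : uniq (ham_paths S x y).
Proof. exact/filter_uniq/permutations_uniq. Qed.

Lemma path_exit (A : {pred T}) x p : path e x p -> x \in A ->
  ~~ all [in A] p ->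
  exists p1 w p2, [/\ p = p1 ++ w :: p2, all [in A] (x :: p1),
                      e (last x p1) w & w \notin A].
Proof.
elim: p x => //= y p IHp x /andP[exy yp] Ax.
case: (boolP (y \in A)) => [Ay /= nAp | nAy _].
  have [p1 [w [p2 [-> Ap1 ew nAw]]]] := IHp y yp Ay nAp.
  by exists (y :: p1), w, p2; split=> //=; rewrite Ax.
by exists [::], y, p; rewrite /= Ax.
Qed.

(** * Hamiltonian paths across a partition with few crossing edges *)

Section Cut.

Variables (B D : {set T}) (x y u w : T).
Hypotheses (sym_e : symmetric e) (disjBD : [disjoint B & D]).

(* The alternative [(z, t) = (x, y)] is harmless: such an edge joins the two ends of
   the path, hence is not one of its edges. *)
Lemma size_ham_paths_cut : e u w -> x \in B -> y \in D -> 2 < #|B :|: D| ->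
  (forall z t, z \in B -> t \in D -> e z t ->
     (z = u) * (t = w) \/ (z = x) * (t = y)) ->
  size (ham_paths (B :|: D) x y) =
  size (ham_paths B x u) * size (ham_paths D w y).
Proof.
move=> euw xB yD gt2 cut.
have inD z : z \in B :|: D -> z \notin B -> z \in D.
  by rewrite inE => /orP[->|].
have BD z : z \in B -> z \in D -> False.
  by move=> zB; rewrite (disjointFr disjBD zB).
rewrite -(size_allpairs cat); apply: perm_size; apply: uniq_perm.
- exact: ham_paths_uniq.
- apply: allpairs_uniq; rewrite ?ham_paths_uniq // => -[s1 s2] [t1 t2].
  move=> /allpairsP[[i j] [/= Hi Hj [-> ->]]] /allpairsP[[i' j'] [/= Hi' Hj' [-> ->]]].
  (* Concatenation is injective here because every first half has exactly [#|B|] entries. *)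
  move=> E; have szB s : s \in ham_paths B x u -> size s = #|B|.
    case/mem_ham_paths=> p [_ _ _ us sB].
    by rewrite -(card_uniqP us); apply: eq_card.
  move/eqP: E; rewrite eqseq_cat ?(szB _ Hi) ?(szB _ Hi') //.
  by case/andP=> /eqP-> /eqP->.
move=> s; apply/idP/allpairsP; last first.
  move=> [[s1 s2] /= [/mem_ham_paths[p [-> xp pu us1 s1B]]]].
  case/mem_ham_paths=> q [-> wq qy us2 s2D] ->.
  apply/mem_ham_paths; exists (p ++ w :: q); split=> //.
  - by rewrite cat_path xp /= pu euw.
  - by rewrite last_cat.
  - rewrite cat_uniq us1 us2 andbT; apply/hasPn=> z.
    by rewrite s2D s1B => zD; apply/negP=> /BD; apply.
  - by move=> z; rewrite mem_cat s1B s2D inE.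
case/mem_ham_paths=> p [-> xp py us sBD].
(* The path starts in [B] and ends in [D]; split it where it first leaves [B]. *)
have [|p1 [t [p2 [Ep /= /andP[_ p1B] ez tB]]]] := path_exit (A := mem B) xp xB.
  apply/negP=> /allP pB; apply: (BD y) => //.
  have:= mem_last x p; rewrite py inE => /orP[/eqP-> //|]; exact: pB.
have tD : t \in D by apply: inD tB; rewrite -sBD Ep inE mem_cat mem_head !orbT.
have zB : last x p1 \in B.
  have:= mem_last x p1; rewrite inE => /orP[/eqP-> //|]; exact: (allP p1B).
have x_p1 : x \notin p1 ++ t :: p2 by move: us; rewrite Ep => /andP[].
have utp2 : uniq (t :: p2) by move: us; rewrite Ep -cat_cons cat_uniq => /and3P[].
have py2 : last t p2 = y by rewrite -py Ep last_cat.
have [Ez Et] : (last x p1 = u) * (t = w).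
  (* If the crossing went from [x] to [y], then nothing could precede it or follow it without
     repeating an end, so the path would have only two vertices. *)
  case: (cut _ _ zB tD ez) => // -[Ex Ey]; case: notF.
  have {}Ep1 : p1 = [::].
    case/lastP: (p1) x_p1 Ex => // h l + E; rewrite last_rcons in E.
    by rewrite E mem_cat mem_rcons mem_head.
  have {}Ep2 : p2 = [::].
    case/lastP: (p2) utp2 py2 => // h l; rewrite last_rcons Ey.
    by move=> /andP[+ _] E; rewrite E mem_rcons mem_head.
  move: gt2; rewrite -(eq_card sBD) Ep Ep1 Ep2 => gt2.
  by have:= leq_trans gt2 (card_size _).
have p2D : all [in D] p2.
  (* A return to [B] would run along a crossing edge backwards, hence arrive at [u] or at [x], both
     already visited. *)
  apply/negPn/negP=> np2.
  have tp2 : path e t p2 by move: xp; rewrite Ep cat_path /= => /and3P[].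
  have [q1 [z [q2 [Ep2 /= /andP[_ q1D] ez' zD]]]] := path_exit (A := mem D) tp2 tD np2.
  have z'B : z \in B.
    have: z \in B :|: D by rewrite -sBD Ep Ep2 !(inE, mem_cat) eqxx !orbT.
    by rewrite inE => /orP[//|zD']; rewrite zD' in zD.
  have lD : last t q1 \in D.
    have:= mem_last t q1; rewrite inE => /orP[/eqP-> //|]; exact: (allP q1D).
  have ex : e z (last t q1) by rewrite sym_e.
  case: (cut _ _ z'B lD ex) => [[Eu _]|[Ex _]].
    have: u \in x :: p1 by rewrite -Ez mem_last.
    move: us; rewrite Ep -cat_cons cat_uniq => /and3P[_ /hasPn Hn _].
    apply/negP; apply: Hn; by rewrite Ep2 -Eu !(inE, mem_cat) eqxx !orbT.
  by move: x_p1; rewrite Ep2 -Ex !(inE, mem_cat) eqxx !orbT.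
exists (x :: p1, t :: p2); rewrite /= Ep; split=> //.
  apply/mem_ham_paths; exists p1; split=> //.
  - by move: xp; rewrite Ep cat_path => /andP[].
  - by move: us; rewrite Ep -cat_cons cat_uniq => /andP[].
  - move=> z; apply/idP/idP; first by rewrite inE => /orP[/eqP-> //|/(allP p1B)].
    move=> Bz; have: z \in x :: p by rewrite sBD inE Bz.
    rewrite Ep -cat_cons mem_cat => /orP[//|].
    by rewrite inE => /orP[/eqP Ezt|/(allP p2D) /(BD _ Bz) //]; rewrite Ezt (negPf tB) in Bz.
rewrite -Et; apply/mem_ham_paths; exists p2; split=> //.
- by move: xp; rewrite Ep cat_path /= => /and3P[].
- move=> z; apply/idP/idP; first by rewrite inE => /orP[/eqP-> //|/(allP p2D)].
  move=> Dz; have: z \in x :: p by rewrite sBD inE Dz orbT.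
  rewrite Ep -cat_cons mem_cat => /orP[|//].
  by rewrite inE => /orP[/eqP Ezt|/(allP p1B) /BD /(_ Dz) //]; case: (BD x) => //; rewrite -Ezt.
Qed.

(** If the first step from [v] went into [D], the path would have to enter [B] to reach [x] and come
    back to [D] to end at [y]. Both crossings use the edge between [u] and [w], so [w] would be
    visited twice. Hence the first step goes into [B], where [x] is the only neighbour of [v]. *)
Lemma size_ham_paths_cons v : x \in B -> y \in D -> v \notin B :|: D -> e v x ->
  (forall z, z \in B -> e v z -> z = x) ->
  (forall z t, z \in B -> t \in D -> e z t -> (z = u) * (t = w)) ->
  size (ham_paths (v |: (B :|: D)) v y) = size (ham_paths (B :|: D) x y).
Proof.
move=> xB yD vBD evx vB cut.
have BD z : z \in B -> z \in D -> False.
  by move=> zB; rewrite (disjointFr disjBD zB).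
rewrite -(size_map (cons v) (ham_paths _ x y)); apply: perm_size; apply: uniq_perm.
- exact: ham_paths_uniq.
- by rewrite map_inj_uniq ?ham_paths_uniq // => s t [].
move=> s; apply/idP/mapP; last first.
  case=> s1 /mem_ham_paths[p [-> xp py up pBD]] ->.
  apply/mem_ham_paths; exists (x :: p); split=> //=; first by rewrite evx.
    by rewrite pBD vBD.
  by move=> z; rewrite inE pBD !inE.
case/mem_ham_paths=> p [-> vp py us sBD].
have pBD : p =i B :|: D.
  move=> z; have:= sBD z; rewrite !inE; case: eqP => [->|_] //= _.
  by move: us vBD; rewrite /= inE => /andP[/negPf-> _] /negPf->.
exists p => //; apply/mem_ham_paths.
case: p => [|z q] in vp py us sBD pBD *.
  by have:= pBD x; rewrite !inE xB.
move: vp us => /= /andP[evz zq] /andP[_ us].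
suffices Ezx : z = x by rewrite -Ezx; exists q.
have: z \in B :|: D by rewrite -pBD mem_head.
rewrite inE => /orP[zB|zD]; first exact: vB.
(* First crossing, from [D] into [B]: it leaves from [w]. *)
have [|p1 [t [p2 [Eq p1D et tD]]]] := path_exit (A := mem D) zq zD.
  apply/negP=> /allP qD; have:= pBD x; rewrite !inE xB /=.
  by case/orP=> [/eqP Exz|/qD /(BD _ xB) //]; apply: (BD x); rewrite // Exz.
have tB : t \in B.
  have:= pBD t; rewrite Eq !(inE, mem_cat) eqxx (negPf tD) !orbT orbF.
  by move/esym; apply.
have lD : last z p1 \in D by apply: (allP p1D); apply: mem_last.
have ep : e t (last z p1) by rewrite sym_e.
have [Etu Elw] := cut _ _ tB lD ep.
have tp2 : path e t p2 by move: zq; rewrite Eq cat_path /= => /and3P[].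
(* Second crossing, back into [D]: it arrives at [w] again. *)
have [|q1 [r [q2 [Ep2 q1B er rB]]]] := path_exit (A := mem B) tp2 tB.
  apply/negP=> /allP p2B; apply: (BD y) => //; rewrite -py Eq /= last_cat /=.
  have:= mem_last t p2; rewrite inE => /orP[/eqP-> //|]; exact: p2B.
have rD : r \in D.
  have:= pBD r; rewrite Eq Ep2 !(inE, mem_cat) eqxx (negPf rB) !orbT.
  by move/esym.
have lB : last t q1 \in B by apply: (allP q1B); apply: mem_last.
have [_ Erw] := cut _ _ lB rD er.
move: us; rewrite -cons_uniq Eq -cat_cons cat_uniq => /and3P[_ /hasPn/(_ w) + _].
have->: w \in t :: p2 by rewrite Ep2 -Erw !(inE, mem_cat) eqxx !orbT.
by move/(_ isT); rewrite -Elw mem_last.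
Qed.

End Cut.

(** The vertices other than the two ends can come in any order. The edge between [x] and [y] may be
    missing, since a path joining them through at least one other vertex never uses it. *)
Lemma size_ham_paths_complete (S : {set T}) x y :
  x \in S -> y \in S -> x != y -> 2 < #|S| ->
  (forall z t, z \in S -> t \in S -> z != t -> [set z; t] != [set x; y] -> e z t) ->
  size (ham_paths S x y) = (#|S| - 2)`!.
Proof.
move=> xS yS nxy gt2 compl.
pose M := S :\ x :\ y.
have cardM : #|M| = #|S| - 2.
  by have:= cardsD1 x S; have:= cardsD1 y (S :\ x); rewrite -/M !inE xS yS eq_sym nxy /=; lia.
have sM z : (z \in S) = [|| z == x, z == y | z \in M].
  rewrite !inE; case: eqP => [->|_]; first by rewrite xS.
  by case: eqP => [->|_]; first by rewrite yS.
have nxM : x \notin M by rewrite !inE eqxx andbF.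
have nyM : y \notin M by rewrite !inE eqxx.
rewrite -cardM cardE -size_permutations ?enum_uniq //.
rewrite -(size_map (fun p => x :: rcons p y) (permutations _)); apply: perm_size; apply: uniq_perm.
- exact: ham_paths_uniq.
- rewrite map_inj_uniq ?permutations_uniq // => s t [].
  by move/rcons_inj=> [].
move=> s; apply/idP/mapP.
  case/mem_ham_paths=> p [-> xp py us sS].
  case/lastP: p => [|p y'] in xp py us sS *.
    by rewrite /= in py; rewrite py eqxx in nxy.
  rewrite last_rcons in py; rewrite {}py in xp us sS *.
  exists p => //; rewrite mem_permutations.
  move: us; rewrite /= mem_rcons inE negb_or rcons_uniq => /andP[/andP[_ xp'] /andP[yp up]].
  apply: uniq_perm; rewrite ?enum_uniq // => z; rewrite mem_enum.
  have:= sS z; rewrite inE mem_rcons inE sM.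
  case: eqP => [->|_]; first by rewrite (negPf nxM) (negPf xp').
  by case: eqP => [->|_] //; rewrite (negPf nyM) (negPf yp).
case=> p; rewrite mem_permutations => pM ->.
have up : uniq p by rewrite (perm_uniq pM) enum_uniq.
have mp : p =i M by move=> z; rewrite (perm_mem pM) mem_enum.
have us : uniq (x :: rcons p y).
  by rewrite /= mem_rcons inE negb_or nxy mp nxM rcons_uniq mp nyM up.
have sS : x :: rcons p y =i S by move=> z; rewrite inE mem_rcons inE mp sM.
apply/mem_ham_paths; exists (rcons p y); split=> //; last by rewrite last_rcons.
have pS : {subset p <= S} by move=> z zp; rewrite -sS inE mem_rcons inE zp !orbT.
(* Past the first step both vertices differ from [x], so no step is the exempt pair. *)
have pathD q h : uniq (h :: q) -> {subset h :: q <= S :\ x} -> path e h q.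
  elim: q h => //= r q IHq h /andP[hq uq] sub.
  have hS := sub h (mem_head _ _).
  have rS : r \in S :\ x by apply: sub; rewrite !inE eqxx orbT.
  rewrite IHq // ?andbT; last by move=> z zq; apply: sub; rewrite inE zq orbT.
  move: hS rS; rewrite !inE => /andP[hx hS] /andP[rx rS]; apply: compl => //.
    by apply: contraNneq hq => ->; rewrite mem_head.
  apply/eqP=> /setP/(_ x); rewrite !inE eqxx /= !(eq_sym x) (negPf hx) (negPf rx).
  by [].
(* As [2 < #|S|], there is an interior vertex, so the step out of [x] does not go to [y]. *)
have: 0 < size p by rewrite (perm_size pM) -cardE cardM; lia.
case: p => // h l in pM up mp us sS pS * => _.
have /and3P[hy hx hS] : [&& h != y, h != x & h \in S].
  by have:= mp h; rewrite mem_head !inE => /esym.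
rewrite rcons_cons /=; apply/andP; split.
  apply: compl; rewrite // 1?eq_sym //.
  by apply/eqP=> /setP/(_ y); rewrite !inE eqxx orbT (eq_sym y x) (negPf nxy) eq_sym (negPf hy).
apply: pathD; first by move: us; rewrite rcons_cons => /andP[].
move=> z; rewrite -rcons_cons => zp; rewrite !inE -sS inE zp orbT andbT.
by apply: contraTneq zp => ->; move: us => /andP[].
Qed.

End HamiltonianPaths.

(** * From Hamiltonian cycles, as edge sets, to Hamiltonian paths *)

Section HamiltonianCycles.

Variables (T : finType) (e : rel T).
Hypothesis sym_e : symmetric e.

Lemma cycle_edges_rot i (s : seq T) :
  uniq s -> cycle_edges (rot i s) = cycle_edges s.
Proof.
move=> us; apply/setP=> E; apply/imsetP/imsetP=> -[z zs ->]; exists z;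
  by rewrite ?next_rot //; rewrite mem_rot in zs *.
Qed.

Lemma cycle_edges_rev (s : seq T) :
  uniq s -> cycle_edges (rev s) = cycle_edges s.
Proof.
move=> us; apply/setP=> E; apply/imsetP/imsetP=> -[z zs ->].
  exists (prev s z); first by rewrite mem_prev -mem_rev.
  by rewrite next_prev // next_rev // setUC.
by exists (next s z); rewrite ?mem_rev ?mem_next // next_rev // prev_next // setUC.
Qed.

Lemma mem_cycle_edges (s : seq T) z t : uniq s ->
  [set z; t] \in cycle_edges s -> t = next s z \/ t = prev s z.
Proof.
move=> us /imsetP[r _ /setP E].
have := E z; have := E t; have := E r; have := E (next s r).
rewrite !inE !eqxx !orbT /=.
have [->|nzr] := eqVneq z r.
  move=> + _ + _; case/orP=> [/eqP-> |/eqP->]; last by left.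
  by rewrite orbb => /esym/eqP->; left.
by move=> _ /= /eqP<- _ /esym/eqP->; right; rewrite prev_next.
Qed.

(* The edge set of a cycle gives the two neighbours of [z]; once one of them is known
   to be the predecessor, the other one is the successor. *)
Lemma next_determined (s t : seq T) z : uniq s -> uniq t ->
  cycle_edges s = cycle_edges t -> z \in s -> z \in t ->
  prev s z = prev t z -> next s z = next t z.
Proof.
move=> us ut est zs zt Ep.
have /(mem_cycle_edges ut)[//|E1] : [set z; next s z] \in cycle_edges t.
  by rewrite -est; apply/imsetP; exists z.
have /(mem_cycle_edges us)[//|E2] : [set z; next t z] \in cycle_edges s.
  by rewrite est; apply/imsetP; exists z.
by rewrite E1 E2.
Qed.

Lemma prev_head x (p : seq T) : uniq (x :: p) -> prev (x :: p) x = last x p.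
Proof.
move=> us; have : path (frel (next (x :: p))) x (rcons p x) by apply: (cycle_next us).
by rewrite rcons_path => /andP[_ /eqP Ex]; rewrite -{2}Ex prev_next.
Qed.

Lemma uniq_cycle_iter x (p : seq T) i : uniq (x :: p) -> i < size p ->
  nth x p i = iter i.+1 (next (x :: p)) x.
Proof.
move=> us; have : path (frel (next (x :: p))) x (rcons p x) by apply: (cycle_next us).
rewrite rcons_path => /andP[/fpathP[n En] _] lt_i.
rewrite {1}En; rewrite En size_traject in lt_i.
by rewrite (set_nth_default (next (x :: p) x)) ?size_traject // nth_traject // iterSr.
Qed.

(** An edge set determines its cycle up to the starting point and the direction. The common head [x]
    fixes the first and the common last vertex the second; the successors then agree one after
    another. *)
Lemma cycle_edges_inj x (p q : seq T) : uniq (x :: p) -> uniq (x :: q) ->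
  x :: p =i x :: q -> last x p = last x q ->
  cycle_edges (x :: p) = cycle_edges (x :: q) -> p = q.
Proof.
move=> up uq pq lpq Epq.
(* Agreement of the predecessors is carried along because [next_determined] needs it at each
   step. *)
have E i : iter i (next (x :: p)) x = iter i (next (x :: q)) x
    /\ prev (x :: p) (iter i (next (x :: p)) x) = prev (x :: q) (iter i (next (x :: p)) x).
  elim: i => [|i [IH1 IH2]]; first by rewrite !prev_head.
  rewrite !iterS.
  have zp : iter i (next (x :: p)) x \in x :: p.
    by elim: i {IH1 IH2} => [|i IHi]; rewrite ?mem_head // iterS mem_next.
  have En := next_determined up uq Epq zp (etrans (esym (pq _)) zp) IH2.
  by rewrite -IH1 -En; split=> //; rewrite prev_next // En prev_next.
have Es : size p = size q.
  by have := perm_size (uniq_perm up uq pq) => -[].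
apply: (@eq_from_nth _ x) => // i lt_i.
by rewrite !uniq_cycle_iter -?Es // (E i.+1).1.
Qed.

(** Removing the edge between [x] and [y], which every Hamiltonian cycle uses, leaves a Hamiltonian
    path from [x] to [y]; closing up such a path is the inverse. *)
Lemma card_hamiltonian_cycles x y : 2 < #|T| -> e x y ->
  (forall s, ucycle e s -> s =i T -> y = next s x \/ x = next s y) ->
  #|hamiltonian_cycles e| = size (ham_paths e setT x y).
Proof.
move=> gt2 exy used.
have tuple_of (s : seq T) : uniq s -> s =i T -> size s = #|T|.
  by move=> us sT; rewrite -(card_uniqP us); apply: eq_card.
rewrite -(size_map (fun s => cycle_edges s)); set L := map _ _.
have uL : uniq L.
  rewrite map_inj_in_uniq ?ham_paths_uniq // => s t.
  move=> /mem_ham_paths[p [-> _ yp up pT]] /mem_ham_paths[q [-> _ yq uq qT]] E.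
  congr cons; apply: (@cycle_edges_inj x) => //; last by rewrite yp.
  by move=> z; rewrite pT qT.
rewrite -(card_uniqP uL); apply: eq_card => E.
apply/imsetP/mapP=> [[s]|[s /mem_ham_paths[p [-> xp yp up pT]] ->]]; last first.
  have sz : size (x :: p) == #|T|.
    by apply/eqP/tuple_of => // z; rewrite pT inE.
  exists (Tuple sz) => //; rewrite inE gt2 /= /ucycleb up andbT.
  by rewrite /= rcons_path xp yp sym_e.
rewrite inE gt2 /= => cs ->.
have {cs} /andP[cs us] : ucycle e s by [].
have sT : tval s =i T.
  have : size s = #|T| by rewrite size_tuple.
  move=> sz z; have /subset_cardP : #|s| = #|T| by rewrite (card_uniqP us).
  by move=> /(_ (subset_predT _)) ->.
move: (tval s) us cs sT => {}s us cs sT.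
(* Reversal keeps the edge set, so [x] may be taken to follow [y]; the rotation that starts at [x]
   then ends at [y]. *)
wlog Exy : s us cs sT / x = next s y.
  move=> W; have [Ey|/W] := used s (introT andP (conj cs us)) sT; last exact.
  have := W (rev s); rewrite rev_uniq cycle_edges_rev //; apply=> //.
  - by rewrite rev_cycle (eq_cycle (e' := e)).
  - by move=> z; rewrite mem_rev sT.
  - by rewrite next_rev // Ey prev_next.
have /rot_to[i p Ep] : x \in s by rewrite sT.
have up : uniq (x :: p) by rewrite -Ep rot_uniq.
exists (x :: p); last by rewrite -Ep cycle_edges_rot.
apply/mem_ham_paths; exists p; split=> //.
- by move: cs; rewrite -(rot_cycle i) Ep /= rcons_path => /andP[].
- by rewrite -prev_head // -Ep Exy -(next_rot i us) prev_next // rot_uniq.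
- by move=> z; rewrite -Ep mem_rot sT !inE.
Qed.

Lemma next_exit (A : {set T}) (s : seq T) z0 z1 : uniq s -> z0 \in s -> z1 \in s ->
  z0 \in A -> z1 \notin A -> exists z, [/\ z \in s, z \in A & next s z \notin A].
Proof.
move=> us z0s z1s z0A z1A; have [i p Ep] := rot_to z0s.
have : fcycle (next s) (rot i s) by rewrite rot_cycle; apply: cycle_next.
rewrite Ep /= rcons_path => /andP[zp _].
have [|p1 [w [p2 [Ep1 p1A /eqP ez wA]]]] := path_exit (A := mem A) zp z0A.
  apply/negP=> /allP pA; have: z1 \in z0 :: p by rewrite -Ep mem_rot.
  rewrite inE => /orP[/eqP E|/pA]; last by rewrite /= (negPf z1A).
  by rewrite E z0A in z1A.
have zs : last z0 p1 \in z0 :: p.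
  by rewrite Ep1 -cat_cons mem_cat mem_last.
exists (last z0 p1); rewrite ez; split=> //; first by rewrite -(mem_rot i) Ep.
exact: (allP p1A _ (mem_last _ _)).
Qed.

(** The cycle leaves [A] and comes back. If neither crossing used the edge between [x] and [y], both
    would use the one between [u] and [w], and the cycle would close up on these two vertices. *)
Lemma ham_cycle_cut (A : {set T}) x y u w z0 z1 s : 2 < #|T| ->
  z0 \in A -> z1 \notin A ->
  (forall z t, z \in A -> t \notin A -> e z t ->
     (z = x) * (t = y) \/ (z = u) * (t = w)) ->
  ucycle e s -> s =i T -> y = next s x \/ x = next s y.
Proof.
move=> gt2 z0A z1A cut /andP[cs us] sT.
have edge z : e z (next s z) by apply: (next_cycle cs); rewrite sT.
have exit B z0' z1' := @next_exit B s z0' z1' us (sT z0') (sT z1').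
have [z [_ zA nzA]] := exit A z0 z1 z0A z1A.
have [[Ex Ey]|[Eu Ew]] := cut _ _ zA nzA (edge z); first by left; rewrite -Ey Ex.
have [||r [_]] := exit (~: A) z1 z0; rewrite ?inE ?negbK // => rA nrA.
have [|[Ex Ey]|[Eu' Ew']] := cut _ _ nrA rA; first by rewrite sym_e edge.
  by right; rewrite -Ex Ey.
rewrite Eu in Ew; rewrite Ew' in Eu'.
(* Now [u] and [w] are each other's successors, but a third vertex [t] forces the cycle to leave
   [[set u; w]]. *)
have /existsP[t tuw] : [exists t, t \notin [set u; w]].
  rewrite -negb_forall; apply: contraL gt2 => /forallP all_uw.
  have : [set: T] \subset [set u; w] by apply/subsetP=> t _.
  by move/subset_leq_card; rewrite cardsT cards2; case: (u != w); lia.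
rewrite !inE in tuw; have [||q [_ + /negP[]]] := exit [set u; w] u t; rewrite ?inE ?eqxx //.
by case/orP=> /eqP->; rewrite ?Ew ?Eu' eqxx ?orbT.
Qed.

End HamiltonianCycles.

(** For the degree counts: a vertex cannot be both [v j] and [a j], or both [v j] and [b j], so at
    most one alternative is live. *)
Lemma card_set_guard2 (T : finType) (p q : bool) (s t : T) : p && q = false ->
  #|[set d | p && (d == s) || q && (d == t)]| = p || q.
Proof.
case: p; case: q => // _ /=.
- by rewrite -(cards1 s); apply: eq_card => d; rewrite !inE orbF.
- by rewrite -(cards1 t); apply: eq_card => d; rewrite !inE.
- by apply: eq_card0 => d; rewrite !inE.
Qed.

(** * Adjacency and Hamiltonian cycles in the graph *)

Section Gnk.

Variables (m k : nat) (v a b : 'I_m -> 'I_k.+1).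
Hypotheses (hk : 3 <= k) (hm : 2 <= m).
Hypotheses (hva : forall j : 'I_m, j.+1 < m -> a j != v j)
    (hvb : forall j : 'I_m, 0 < j -> b j != v j)
    (hab : forall j : 'I_m, 0 < j -> j.+1 < m -> a j != b j).

Notation vertex := ('I_m * 'I_k.+1)%type.
Notation g := (Gnk v a b).

Lemma Gnk_sym : symmetric g.
Proof.
move=> x y; rewrite /Gnk /= /copies /= (eq_sym x.1) (eq_sym x.2) (orbC (added _ _ _ x y)).
by rewrite (orbC (deleted _ _ _ x y)).
Qed.

Lemma Gnk_irr : irreflexive g.
Proof. by move=> x; rewrite /Gnk /copies /added /= !eqxx /= orbb; lia. Qed.

(** Edges inside a copy keep the index and added edges change it by one, so only the two edges added
    between copies [j] and [j.+1] cross this gap. *)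
Lemma Gnk_cross (j : nat) (z t : vertex) : j < z.1 -> t.1 <= j -> g z t ->
  [/\ t.1 = j :> nat, z.1 = j.+1 :> nat &
      (z.2 = v z.1) /\ (t.2 = v t.1) \/ (z.2 = b z.1) /\ (t.2 = a t.1)].
Proof.
move=> jz tj /or3P[/andP[/andP[/eqP E _] _]|/andP[/eqP E _]|/andP[/eqP E vab]].
- by rewrite E in jz; lia.
- by lia.
- split; [lia|lia|].
  by case/orP: vab => /andP[/eqP-> /eqP->]; [left|right].
Qed.

Lemma Gnk_same (j : 'I_m) (z t : vertex) : z.1 = j -> t.1 = j -> z != t ->
  (j.+1 < m -> [set z; t] != [set (j, v j); (j, a j)]) ->
  (0 < j -> [set z; t] != [set (j, v j); (j, b j)]) -> g z t.
Proof.
case: z t => [j' c] [j'' d] /= -> -> cd nva nvb.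
have ncd : c != d by apply: contraNneq cd => ->.
apply/orP; left; rewrite /copies /deleted /= !eqxx ncd /=.
apply/negP; case/orP=> /andP[/eqP E /orP[]] /andP[lt_j /eqP E'].
- by have:= nva lt_j; rewrite E E' eqxx.
- by have:= nvb lt_j; rewrite E E' eqxx.
- by have:= nva lt_j; rewrite E E' setUC eqxx.
- by have:= nvb lt_j; rewrite E E' setUC eqxx.
Qed.

Definition upper (j : nat) : {set vertex} := [set z : vertex | j <= z.1].
Definition layer (j : 'I_m) (P : {set 'I_k.+1}) : {set vertex} :=
  [set z : vertex | (z.1 == j) && (z.2 \in P)].

Lemma card_layer (j : 'I_m) (P : {set 'I_k.+1}) : #|layer j P| = #|P|.
Proof.
rewrite -(card_imset (mem P) (_ : injective (pair j))); last by move=> c d [].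
apply: eq_card => -[i c]; rewrite !inE /=; apply/andP/imsetP.
  by case=> /eqP-> cP; exists c.
by case=> d dP [-> ->]; rewrite eqxx.
Qed.

(** The only edge missing from the first copy joins the two prescribed ends. *)
Lemma size_ham_paths_layer0 (j : 'I_m) : j = 0 :> nat ->
  size (ham_paths g (layer j setT) (j, a j) (j, v j)) = (k - 1)`!.
Proof.
move=> j0; rewrite size_ham_paths_complete ?card_layer ?cardsT ?card_ord ?inE ?eqxx //.
- by rewrite xpair_eqE eqxx /= hva //; lia.
- by lia.
move=> z t; rewrite !inE !andbT => /eqP zj /eqP tj nzt nzt'.
by apply: (Gnk_same zj tj nzt) => // [_|]; [rewrite (setUC [set (j, v j)])|lia].
Qed.

Lemma size_ham_paths_top (j : 'I_m) : j.+1 = m ->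
  size (ham_paths g (upper j) (j, v j) (j, b j)) = (k - 1)`!.
Proof.
move=> jm; have -> : upper j = layer j setT.
  apply/setP=> -[i c]; rewrite !inE /= andbT; apply/idP/eqP=> [le_ji|->//].
  by apply: val_inj; have:= ltn_ord i; rewrite /=; lia.
rewrite size_ham_paths_complete ?card_layer ?cardsT ?card_ord ?inE ?eqxx //.
- by rewrite xpair_eqE eqxx /= eq_sym hvb //; lia.
- by lia.
move=> z t; rewrite !inE !andbT => /eqP zj /eqP tj nzt nzt'.
by apply: (Gnk_same zj tj nzt) => // lt_j; lia.
Qed.

(** Both deleted edges contain [v j], so what remains of the copy is complete on [k] vertices. *)
Lemma size_ham_paths_middle (j : 'I_m) : 0 < j -> j.+1 < m ->
  size (ham_paths g (layer j [set~ v j]) (j, a j) (j, b j)) = (k - 2)`!.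
Proof.
move=> j0 jm; have cD : #|[set~ v j]| = k by rewrite cardsC1 card_ord.
rewrite size_ham_paths_complete ?card_layer ?cD ?inE ?eqxx ?hva ?hvb //.
  by rewrite xpair_eqE eqxx hab.
move=> z t; rewrite !inE => /andP[/eqP zj zv] /andP[/eqP tj tv] nzt _.
have nv w : [set z; t] != [set (j, v j); w].
  apply/eqP=> /setP/(_ (j, v j)); rewrite !inE eqxx /= => /orP[]/eqP E.
    by rewrite -E eqxx in zv.
  by rewrite -E eqxx in tv.
exact: (Gnk_same zj tj nzt).
Qed.

Lemma Gnk_vv (i j : 'I_m) : i = j.+1 :> nat -> g (j, v j) (i, v i).
Proof. by move=> ij; rewrite /Gnk /added /= ij !eqxx !orbT. Qed.

Lemma Gnk_ba (i j : 'I_m) : i = j.+1 :> nat -> g (i, b i) (j, a j).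
Proof. by move=> ij; rewrite /Gnk /added /= ij !eqxx !orbT. Qed.

(** Here [d] counts the copies from [j] on other than the last; each contributes one factor
    [(k - 2)!]. *)
Lemma size_ham_paths_upper d (j : 'I_m) : 0 < j -> j + d.+1 = m ->
  size (ham_paths g (upper j) (j, v j) (j, b j)) = (k - 1)`! * (k - 2)`! ^ d.
Proof.
elim: d j => [|d IHd] j j0 jm; first by rewrite size_ham_paths_top ?muln1 //; lia.
have lt_j : j.+1 < m by lia.
pose i := Ordinal lt_j; have Ei : i = j.+1 :> nat by [].
pose D := layer j [set~ v j].
(* The start [v j], the later copies, and the rest of copy [j] are the three pieces for
   [size_ham_paths_cons]. *)
have -> : upper j = (j, v j) |: (upper i :|: D).
  apply/setP=> -[h c]; rewrite !inE xpair_eqE /=.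
  have [->|nhj] := eqVneq h j; first by rewrite leqnn ltnn /=; case: eqP.
  have: h <> j :> nat by move/val_inj; apply/eqP.
  by move=> ?; apply/idP/orP => [|[]]; lia.
have dBD : [disjoint upper i & D].
  apply/pred0P=> z /=; rewrite !inE; apply/negP=> /andP[lt_z /andP[/eqP E _]].
  by rewrite E /= in lt_z; lia.
have cut z t : z \in upper i -> t \in D -> g z t ->
    (z = (i, b i)) * (t = (j, a j)).
  case: z t => [zi zc] [tj tc]; rewrite !inE /= => lt_z /andP[/eqP Ej tv] gzt.
  have [|_ Ez []] := Gnk_cross (z := (zi, zc)) lt_z _ gzt; rewrite /= ?Ej //.
    by case=> _ Etc; rewrite Etc eqxx in tv.
  have {}Ez : zi = i by apply: val_inj.
  by move=> [-> ->]; rewrite Ez.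
have inD c : c != v j -> (j, c) \in D by move=> cv; rewrite !inE eqxx.
have inU c : (i, c) \in upper i by rewrite inE.
rewrite (size_ham_paths_cons Gnk_sym dBD (u := (i, b i)) (w := (j, a j)) (x := (i, v i))).
- rewrite (size_ham_paths_cut Gnk_sym dBD (u := (i, b i)) (w := (j, a j))) //.
  + rewrite IHd //; last by rewrite Ei; lia.
    by rewrite size_ham_paths_middle // expnSr mulnA.
  + exact: Gnk_ba.
  + exact: inD (hvb j0).
  + have := subset_leq_card (subsetUr (upper i) D).
    by rewrite card_layer cardsC1 card_ord; apply: leq_trans.
  by move=> z t zB tD gzt; left; apply: cut.
- exact: inU.
- exact: inD (hvb j0).
- by rewrite !inE /= !eqxx /= orbF -ltnNge.
- exact: Gnk_vv.
- move=> [zi zc]; rewrite inE /= => lt_z; rewrite Gnk_sym => gz.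
  have [//|_ Ez []] := Gnk_cross (z := (zi, zc)) lt_z _ gz; rewrite /=.
    have {}Ez : zi = i by apply: val_inj.
    by case=> -> _; rewrite Ez.
  (* The other crossing edge starts at [a j], which differs from [v j]. *)
  by move=> [_ E]; have:= hva lt_j; rewrite E eqxx.
- exact: cut.
Qed.

Lemma card_hamiltonian_cycles_Gnk :
  #|hamiltonian_cycles g| = (k - 1) ^ 2 * (k - 2)`! ^ m.
Proof.
have m0 : 0 < m by lia.
pose i0 := Ordinal m0; pose i1 := Ordinal hm.
have gt2 : 2 < #|{: vertex}| by rewrite card_prod !card_ord; nia.
have Gsym := Gnk_sym.
(* Since copies are numbered from 0, [upper 1] is everything but the first copy. *)
have cut (z t : vertex) : z \in upper 1 -> t \notin upper 1 -> g z t ->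
    (z = (i1, v i1)) * (t = (i0, v i0)) \/ (z = (i1, b i1)) * (t = (i0, a i0)).
  case: z t => [zi zc] [ti tc]; rewrite !inE /= -ltnNge ltnS => lt_z le_t gzt.
  have [] := Gnk_cross (z := (zi, zc)) (t := (ti, tc)) lt_z le_t gzt; rewrite /=.
  move=> t0 z1; have -> : zi = i1 by apply: val_inj.
  have -> : ti = i0 by apply: val_inj.
  by case=> -[-> ->]; [left|right].
have cutD : [disjoint upper 1 & layer i0 [set: 'I_k.+1]].
  apply/pred0P=> z /=; rewrite !inE; apply/negP=> /andP[lt_z /andP[/eqP E _]].
  by rewrite E in lt_z.
have E : [set: vertex] = upper 1 :|: layer i0 setT.
  apply/setP=> -[[j lt_j] c]; rewrite !inE /= andbT -val_eqE /=.
  by case: j {lt_j}.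
rewrite (@card_hamiltonian_cycles _ g Gsym (i1, v i1) (i0, v i0)) //; first last.
- move=> s; apply: (ham_cycle_cut Gsym gt2 _ _ cut (z0 := (i1, v i1)) (z1 := (i0, v i0))).
    by rewrite inE.
  by rewrite inE.
- by rewrite Gsym; apply: Gnk_vv.
rewrite E (size_ham_paths_cut Gsym cutD (u := (i1, b i1)) (w := (i0, a i0))).
- rewrite size_ham_paths_layer0 // (size_ham_paths_upper (d := m - 2) (j := i1)) //; last first.
    by rewrite /=; lia.
  (* Each extreme copy gives [(k - 1)! = (k - 1) * (k - 2)!], which brings the exponent of
     [(k - 2)!] from [m - 2] up to [m]. *)
  have -> : (k - 1)`! = (k - 1) * (k - 2)`!.
    by have -> : k - 1 = (k - 2).+1 by lia.
  have {2}-> : m = (m - 2).+2 by lia.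
  by rewrite !expnS expn0; nia.
all: try by rewrite !inE ?eqxx.
- exact: Gnk_ba.
- by rewrite -E cardsT.
(* The edge between the two [v] vertices joins the ends of the path and falls under the harmless
   alternative. *)
move=> z t zB tD gzt; have := cut z t zB; rewrite (disjointFl cutD tD).
by case=> // -[-> ->]; [right|left].
Qed.

(** * Regularity: added edges make up for deleted ones *)

Lemma card_added_up (j : 'I_m) c :
  #|[set y | added v a b (j, c) y]| = (j.+1 < m) && ((c == v j) || (c == a j)).
Proof.
have [lt_j|ge_j] /= := boolP (j.+1 < m); last first.
  apply: eq_card0 => -[i d]; rewrite !inE /added /=; apply/negP=> /andP[/eqP E _].
  by have := ltn_ord i; lia.
pose i := Ordinal lt_j.
rewrite -(card_set_guard2 (v i) (b i)); last first.
  by case: (c =P v j) => //= ->; rewrite eq_sym (negPf (hva lt_j)).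
rewrite -(card_layer i); apply: eq_card => -[h d]; rewrite !inE /added /=.
have -> : (j.+1 == h :> nat) = (h == i) by rewrite eq_sym.
by case: eqP => //= ->.
Qed.

Lemma card_added_down (j : 'I_m) c :
  #|[set y | added v a b y (j, c)]| = (0 < j) && ((c == v j) || (c == b j)).
Proof.
have [lt_j|ge_j] /= := boolP (0 < j); last first.
  by apply: eq_card0 => -[i d]; rewrite !inE /added /=; apply/negP=> /andP[/eqP E _]; lia.
have lt_i : j.-1 < m by have := ltn_ord j; lia.
pose i := Ordinal lt_i.
rewrite -(card_set_guard2 (v i) (a i)); last first.
  by case: (c =P v j) => //= ->; rewrite eq_sym (negPf (hvb lt_j)).
rewrite -(card_layer i); apply: eq_card => -[h d]; rewrite !inE /added /=.
have -> : (h.+1 == j :> nat) = (h == i) by rewrite -val_eqE /=; apply/eqP/eqP; lia.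
case: eqP => //= ->; by rewrite !(andbC (d == _)).
Qed.

(** The number subtracted is exactly the sum of the counts in [card_added_up] and
    [card_added_down]. *)
Lemma card_copies_left (j : 'I_m) c :
  #|[set y | copies (j, c) y &&
             ~~ (deleted v a b (j, c) y || deleted v a b y (j, c))]|
  = k - (((j.+1 < m) && ((c == v j) || (c == a j))) +
         ((0 < j) && ((c == v j) || (c == b j)))).
Proof.
(* [U] and [D] are the neighbours lost by deleting the edges from [v j] to [a j] and to [b j]. *)
pose U := [set d | (j.+1 < m) && (c == v j) && (d == a j) ||
                    (j.+1 < m) && (c == a j) && (d == v j)].
pose D := [set d | (0 < j) && (c == v j) && (d == b j) ||
                    (0 < j) && (c == b j) && (d == v j)].
have cU : #|U| = (j.+1 < m) && ((c == v j) || (c == a j)).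
  rewrite card_set_guard2 -?andb_orr //; case: (boolP (j.+1 < m)) => //= lt_j.
  by case: (c =P v j) => //= ->; rewrite eq_sym (negPf (hva lt_j)).
have cD : #|D| = (0 < j) && ((c == v j) || (c == b j)).
  rewrite card_set_guard2 -?andb_orr //; case: (boolP (0 < j)) => //= lt_j.
  by case: (c =P v j) => //= ->; rewrite eq_sym (negPf (hvb lt_j)).
(* The two losses are disjoint because [v j], [a j] and [b j] are distinct where both deletions
   occur, so they add up. *)
have UD : U :&: D = set0.
  apply/setP=> d; rewrite !inE; apply/negP.
  case/andP=> /orP[] /andP[/andP[hm1 /eqP Ec] /eqP Ed];
    case/orP=> /andP[/andP[h0 /eqP Ec'] /eqP Ed'].
  - by have := hab h0 hm1; rewrite -Ed -Ed' eqxx.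
  - by have := hvb h0; rewrite -Ec' Ec eqxx.
  - by have := hva hm1; rewrite -Ec Ec' eqxx.
  - by have := hab h0 hm1; rewrite -Ec -Ec' eqxx.
have sub : U :|: D \subset [set~ c].
  apply/subsetP=> d; rewrite !inE; apply: contraTneq => ->.
  apply/negP=> /orP[]/orP[]/andP[/andP[h /eqP Ec] /eqP Ed].
  - by have := hva h; rewrite -Ed Ec eqxx.
  - by have := hva h; rewrite -Ec Ed eqxx.
  - by have := hvb h; rewrite -Ed Ec eqxx.
  - by have := hvb h; rewrite -Ec Ed eqxx.
rewrite -cU -cD -[_ + _]subn0 -(cards0 'I_k.+1) -UD -cardsU.
have -> : k - #|U :|: D| = #|layer j ([set~ c] :\: (U :|: D))|.
  by rewrite card_layer cardsD (setIidPr sub) cardsC1 card_ord.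
apply: eq_card => -[i d]; rewrite !inE /copies /deleted /= (eq_sym i j) (eq_sym d c).
case: (j =P i) => [<-|] //=; rewrite ?andbF //.
case: (c == d) => //=; rewrite ?andbF ?andbT //; congr negb.
by case: (j.+1 < m); case: (0 < j); case: (c == v j); case: (c == a j);
  case: (c == b j); case: (d == v j); case: (d == a j); case: (d == b j).
Qed.

Lemma Gnk_regular : regular g k.
Proof.
move=> [j c]; pose S := [set y | copies (j, c) y &&
  ~~ (deleted v a b (j, c) y || deleted v a b y (j, c))].
pose U := [set y | added v a b (j, c) y]; pose D := [set y | added v a b y (j, c)].
have -> : [set y | g (j, c) y] = S :|: (U :|: D) by apply/setP=> y; rewrite !inE.
rewrite !cardsU.
(* Neighbours in the same, the next and the previous copy are told apart by the copy index. *)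
have -> : U :&: D = set0.
  apply/setP=> y; rewrite !inE /added /=; apply/negP.
  by move=> /andP[/andP[/eqP + _] /andP[/eqP + _]]; lia.
have -> : S :&: (U :|: D) = set0.
  apply/setP=> y; rewrite !inE /added /copies /=; apply/negP=> /andP[/andP[/andP[/eqP <- _] _]].
  by case/orP=> /andP[/eqP + _]; lia.
rewrite cards0 !subn0 card_added_up card_added_down card_copies_left.
(* At most two neighbours are lost, and [3 <= k] keeps the subtraction from truncating. *)
by do 2![case: (_ && _)]; lia.
Qed.

End Gnk.

Theorem theorem1 (k m n : nat) (hk : 3 <= k) (hm : 2 <= m)
    (hn : n = m * (k + 1))
    (v a b : 'I_m -> 'I_k.+1)
    (hva : forall j : 'I_m, j.+1 < m -> a j != v j)
    (hvb : forall j : 'I_m, 0 < j -> b j != v j)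
    (hab : forall j : 'I_m, 0 < j -> j.+1 < m -> a j != b j) :
  [/\ simple_graph (Gnk v a b),
      regular (Gnk v a b) k,
      #|{: 'I_m * 'I_k.+1}| = n &
      #|hamiltonian_cycles (Gnk v a b)| =
        (k - 1) ^ 2 * ((k - 2)`!) ^ (n %/ (k + 1))].
Proof.
split.
- by split; [apply: Gnk_sym | apply: Gnk_irr].
- exact: Gnk_regular.
- by rewrite card_prod !card_ord hn addn1.
by rewrite hn mulnK ?addn1 // card_hamiltonian_cycles_Gnk.
Qed.
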